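(* Let $G=(V,E)$ be a simple undirected graph with $V=\{v_1,\ldots,v_n\}$, let $K=\{v_1,\ldots,v_k\}$ with $k>1$, and assume that $K$ is an independent set, that each $v_i\in K$ has degree exactly $2$ with $N(v_i)=\{v_{k+2i-1},v_{k+2i}\}$ for $i\in[k]$, and that no two vertices of $K$ have a common neighbour. For each edge $v_iv_j\in E$ with $i<j$ let $x_{ij}$ be a distinct commuting indeterminate, and work over a field of characteristic two. Define the $n\times n$ matrix $M_G$ by: for $i\neq j$, $M_G(i,j)=x_{\min(i,j)\max(i,j)}$ if $v_iv_j\in E$ and $0$ otherwise; $M_G(i,i)=1$ for $i>3k$ and $M_G(i,i)=0$ for $i\le 3k$; and then set $M_G(1,k+2)=M_G(k+1,1)=0$. An orientation of $M_G$ is a matrix obtained from $M_G$ by choosing, independently for every $i\in\{2,\ldots,k\}$, one of the two options: either set $M_G(k+2i-1,i)=M_G(i,k+2i)=0$, or set $M_G(k+2i,i)=M_G(i,k+2i-1)=0$. Let $Q'$ be the sum of $\det M'_G$ over all $2^{k-1}$ orientations $M'_G$ of $M_G$. Then $G$ has a $K$-cycle if and only if $Q'$ is not identically zero (as a polynomial in the $x_{ij}$).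
   Context: A $K$-cycle in $G$ is a (simple) cycle in $G$ passing through every vertex of $K$ (possibly also through other vertices). $N(v)$ denotes the set of neighbours of $v$, and $[k]=\{1,\ldots,k\}$. *)

(* Defs.v *)
From HB Require Import structures.
From mathcomp Require Import all_boot all_order all_algebra.
From mathcomp Require Export mpoly.

Set Implicit Arguments.
Unset Strict Implicit.
Unset Printing Implicit Defensive.

Import Order.TTheory GRing.Theory.
Local Open Scope ring_scope.

(* The vertices v_1, ..., v_n are the elements of 'I_n, and a simple graph on
   them is a symmetric irreflexive relation.  [lab v] is the 1-based index, so
   that lab v_i = i. *)
Definition lab (n : nat) (v : 'I_n) : nat := v.+1.

Definition neighbours (n : nat) (e : rel 'I_n) (v : 'I_n) : {set 'I_n} :=
  [set u | e v u].

Definition independent (n : nat) (e : rel 'I_n) (A : {set 'I_n}) : Prop :=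
  forall u v, u \in A -> v \in A -> ~~ e u v.

Definition terminals (n k : nat) : {set 'I_n} := [set v | (lab v <= k)%N].

(* [ucycle e [:: u; v]] holds for a single edge uv, hence the size condition. *)
Definition has_cycle_through (n : nat) (e : rel 'I_n) (A : {set 'I_n}) : Prop :=
  exists c : seq 'I_n,
    [/\ ucycle e c, (2 < size c)%N & {subset A <= c}].

(* The ambient ring has one indeterminate for each ordered pair of vertices;
   only those of the pairs (i, j) with i < j and v_i v_j an edge are used. *)
Definition edge_var (n : nat) (F : fieldType) (i j : 'I_n) :
    {mpoly F[n * n]} :=
  'X_(mxvec_index (Order.min i j) (Order.max i j)).

Definition adj_matrix (n : nat) (F : fieldType) (e : rel 'I_n) (k : nat) :
    'M[{mpoly F[n * n]}]_n :=
  \matrix_(i, j)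
    if i == j then (if (3 * k < lab i)%N then 1 else 0)
    else if e i j then edge_var F i j else 0.

Definition MG (n : nat) (F : fieldType) (e : rel 'I_n) (k : nat) :
    'M[{mpoly F[n * n]}]_n :=
  \matrix_(i, j)
    if (lab i == 1)%N && (lab j == k + 2)%N
       || (lab i == k + 1)%N && (lab j == 1)%N
    then 0 else adj_matrix F e k i j.

Definition choice_indices (n k : nat) : {set 'I_n} :=
  [set i | (2 <= lab i <= k)%N].

(* A family of choices is encoded by the set [s] of those i in {2, ..., k} for
   which the entries (k+2i-1, i) and (i, k+2i) are set to 0; for the other i,
   the entries (k+2i, i) and (i, k+2i-1) are. *)
Definition oriented_away (n k : nat) (s : {set 'I_n}) (a b : 'I_n) : bool :=
  (b \in choice_indices n k)
    && (lab a == if b \in s then k + 2 * lab b - 1 else k + 2 * lab b)%N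
  || (a \in choice_indices n k)
    && (lab b == if a \in s then k + 2 * lab a else k + 2 * lab a - 1)%N.

Definition orientation (n : nat) (F : fieldType) (e : rel 'I_n) (k : nat)
    (s : {set 'I_n}) : 'M[{mpoly F[n * n]}]_n :=
  \matrix_(a, b) if oriented_away k s a b then 0 else MG F e k a b.

Definition Qprime (n : nat) (F : fieldType) (e : rel 'I_n) (k : nat) :
    {mpoly F[n * n]} :=
  \sum_(s : {set 'I_n} | s \subset choice_indices n k)
    \det (orientation F e k s).

(* Main.v *)
Require Import Defs.
From HB Require Import structures.
From mathcomp Require Import all_boot all_order all_algebra.
From mathcomp Require Import perm zify.

Set Implicit Arguments.
Unset Strict Implicit.
Unset Printing Implicit Defensive.

Import Order.TTheory GRing.Theory.
Local Open Scope ring_scope.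

(** In characteristic two the determinants are permanents, so Q' sums one
    monomial for each permutation s moving vertices along edges, and the
    orientation is determined by s: a terminal is entered from one of its two
    neighbours and left to the other, with the direction at v_1 prescribed.
    Reversing all cycles of s that avoid v_1 preserves the monomial, hence the
    terms of those s with s^2 <> 1 off the cycle of v_1 cancel in pairs.  In the
    remaining s no terminal lies on a 2-cycle or is fixed, so the cycle of v_1
    is a K-cycle.  Conversely, a K-cycle directed as prescribed at v_1, with all
    other vertices fixed, is recovered from its monomial, whose coefficient in
    Q' is therefore 1. *)

(** * Cancellation in characteristic two *)

(** The involution pairs the indices; splitting each pair by enumeration rank gives two equal half
    sums. *)
Lemma sum_fixfree_involution_pchar2 (R : nzRingType) (I : finType)
    (P : pred I) (F : I -> R) (f : I -> I) :
    2%N \in [pchar R] -> involutive f -> (forall i, P (f i) = P i) ->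
    (forall i, P i -> F (f i) = F i) -> (forall i, P i -> f i != i) ->
  \sum_(i | P i) F i = 0.
Proof.
move=> char2 fK fP fF f_free.
rewrite (bigID (fun i => enum_rank i < enum_rank (f i))%N) /=.
rewrite [X in _ + X](reindex_inj (inv_inj fK)) /=.
rewrite [X in _ + X](eq_big (fun i => P i && (enum_rank i < enum_rank (f i))%N)
  F) ?addrr_pchar2 // => i.
  rewrite fP fK; case Pi: (P i) => //=.
  rewrite -leqNgt ltn_neqAle andbC; case: leqP => //= _.
  by rewrite (inj_eq val_inj) (inj_eq enum_rank_inj) eq_sym f_free.
by rewrite fP => /andP[Pi _]; exact: fF.
Qed.

(** * Reversing the cycles that avoid a given vertex *)

Section Flip.

Variables (T : finType) (v : T).
Implicit Types (s : {perm T}) (x y : T).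

Lemma fconnect_perm s y : fconnect s v (s y) = fconnect s v y.
Proof. by rewrite -same_fconnect1_r //; exact: perm_inj. Qed.

Lemma fconnect_finv_perm s y : fconnect s v (finv s y) = fconnect s v y.
Proof. by rewrite -fconnect_perm f_finv //; exact: perm_inj. Qed.

(** Both [s] and its inverse preserve the cycle of [v], so the two pieces are injective with
    disjoint images. *)
Lemma flip_subproof s :
  injective (fun y => if fconnect s v y then s y else finv s y).
Proof.
move=> x y; have := congr1 (fconnect s v).
case cx: (fconnect s v x); case cy: (fconnect s v y) => cE E.
- exact: perm_inj E.
- by have := cE _ _ E; rewrite fconnect_perm fconnect_finv_perm cx cy.
- by have := cE _ _ E; rewrite fconnect_perm fconnect_finv_perm cx cy.
- by rewrite -(f_finv (@perm_inj _ s) x) E (f_finv (@perm_inj _ s)).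
Qed.

(* Reverses every cycle of [s] that does not contain [v]. *)
Definition flip s : {perm T} := perm (@flip_subproof s).

Lemma flipE s y : flip s y = if fconnect s v y then s y else finv s y.
Proof. by rewrite permE. Qed.

Lemma iter_flip s m : iter m (flip s) v = iter m s v.
Proof.
by elim: m => //= m ->; rewrite flipE fconnect_iter.
Qed.

Lemma fconnect_flip s : fconnect (flip s) v =1 fconnect s v.
Proof.
move=> y; apply/idP/idP => /iter_findex <-.
  by rewrite iter_flip fconnect_iter.
by rewrite -iter_flip fconnect_iter.
Qed.

Lemma flipK : involutive flip.
Proof.
move=> s; apply/permP => y; rewrite flipE fconnect_flip.
case cy: (fconnect s v y); first by rewrite flipE cy.
apply: (@perm_inj _ (flip s)); rewrite f_finv; last exact: perm_inj.
by rewrite flipE fconnect_perm cy finv_f //; exact: perm_inj.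
Qed.

Lemma flip_flip_eq s y : (flip s (flip s y) == y) = (s (s y) == y).
Proof.
have sI := @perm_inj _ s.
rewrite flipE [flip s y]flipE; case cy: (fconnect s v y).
  by rewrite fconnect_perm cy.
rewrite fconnect_finv_perm cy -(inj_eq sI) (f_finv sI) -(inj_eq sI) (f_finv sI).
exact: eq_sym.
Qed.

(** On reversed cycles, reindexing by [s] turns the factors into [w (s x) x], and [w] is
    symmetric. *)
Lemma prod_flip (R : comNzRingType) (w : T -> T -> R) s :
    (forall x y, w x y = w y x) ->
  \prod_x w x (flip s x) = \prod_x w x (s x).
Proof.
move=> w_sym; rewrite (bigID (fconnect s v)) [RHS](bigID (fconnect s v)) /=.
congr (_ * _); first by apply: eq_bigr => x cx; rewrite flipE cx.
rewrite (reindex_inj (@perm_inj _ s)) /=.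
apply: eq_big => [x|x]; rewrite fconnect_perm // => /negPf cx.
by rewrite flipE fconnect_perm cx finv_f; [exact: w_sym | exact: perm_inj].
Qed.

End Flip.

(** * Cycles and the undirected edges they use *)

Lemma next_next_neq (T : eqType) (c : seq T) (x : T) :
  uniq c -> (2 < size c)%N -> x \in c -> next c (next c x) != x.
Proof.
move=> Uc c3 xc; have [i c' Dc] := rot_to xc.
rewrite -!(next_rot i Uc) Dc.
have: uniq (x :: c') by rewrite -Dc rot_uniq.
have: (2 < size (x :: c'))%N by rewrite -Dc size_rot.
case: c' {Dc} => [|y [|z c']] //= _.
rewrite !inE !negb_or => /and3P[/and3P[xy xz _] /andP[yz _] _].
by rewrite !eqxx [y == x]eq_sym (negPf xy) ?eqxx eq_sym.
Qed.

(* [s u = t u] forces [s (t u) = t (t u)]: the edge between [t u] and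
   [t (t u)] cannot be used backwards by [s], as [s] maps only [u] to [t u]. *)
Lemma perm_eq_undirected (T : finType) (s t : {perm T}) (v : T) :
    (forall x y, x != y ->
       ((s x == y) + (s y == x) = (t x == y) + (t y == x))%N) ->
    (forall x, fconnect t v x -> t (t x) != x) ->
    (forall x, ~~ fconnect t v x -> t x = x) ->
    s v = t v ->
  s = t.
Proof.
move=> st t_long t_fix st_v; apply/permP => x.
have [vx|/t_fix tx] := boolP (fconnect t v x); last first.
  (* If [s] moved a vertex [x] fixed by [t], the edge from [x] to [s x] would be used by [s] but not
     by [t]. *)
  rewrite tx; apply/eqP/contraT => sx.
  have xsx : x != s x by rewrite eq_sym.
  have tsx : t (s x) != x by rewrite -{2}tx (inj_eq perm_inj).
  by have := st _ _ xsx; rewrite eqxx tx (negPf xsx) (negPf tsx).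
rewrite -(iter_findex vx); elim: (findex _ _ _) => //= m IH.
set u := iter m t v in IH *.
have vu : fconnect t v u by exact: fconnect_iter.
have ttu : t (t u) != u by exact: t_long.
have tu : t u != t (t u).
  by rewrite (inj_eq perm_inj); apply: contraNneq ttu => utu; rewrite -!utu.
have sttu : s (t (t u)) != t u by rewrite -[X in _ == X]IH (inj_eq perm_inj).
by have := st _ _ tu; rewrite eqxx (negPf sttu); case: eqP.
Qed.

(** * Monomials of edges and permutations *)

Lemma lab_inj (n : nat) : injective (@lab n).
Proof. by move=> i j [] /val_inj. Qed.

Lemma mxvec_index_eq (m n : nat) (i i' : 'I_m) (j j' : 'I_n) :
  (mxvec_index i j == mxvec_index i' j') = (i == i') && (j == j').
Proof.
have mxvecI := onT_bij (curry_mxvec_bij m n).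
exact: (inj_eq (bij_inj mxvecI) (i, j) (i', j')).
Qed.

(** The zero exponent for [i = j] stands for a diagonal entry 1. *)
Definition edge_mnm (n : nat) (i j : 'I_n) : 'X_{1.. n * n} :=
  if i == j then 0%MM else U_(mxvec_index (Order.min i j) (Order.max i j))%MM.

Lemma edge_mnmE (n : nat) (i j u v : 'I_n) : u != v ->
  edge_mnm i j (mxvec_index (Order.min u v) (Order.max u v)) =
    ((i == u) && (j == v) + (i == v) && (j == u))%N.
Proof.
move=> uv; rewrite /edge_mnm; have [<-|ij] := eqVneq i j.
  rewrite mnm0E; have [->|_] := eqVneq i u; last by rewrite andbF.
  by rewrite (negPf uv).
rewrite mnm1E mxvec_index_eq.
move: uv ij; rewrite !minElt !maxElt !ltEord -!(inj_eq val_inj) /=.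
by case: ifP; case: ifP; lia.
Qed.

Definition perm_mnm (n : nat) (s : 'S_n) : 'X_{1.. n * n} :=
  (\sum_i edge_mnm i (s i))%MM.

(** The exponents record [s] up to the direction of its edges, as the first hypothesis of
    [perm_eq_undirected] requires. *)
Lemma perm_mnmE (n : nat) (s : 'S_n) (u v : 'I_n) : u != v ->
  perm_mnm s (mxvec_index (Order.min u v) (Order.max u v)) =
    ((s u == v) + (s v == u))%N.
Proof.
move=> uv; rewrite mnm_sumE.
under eq_bigr do rewrite edge_mnmE //.
rewrite big_split /= (bigD1 u) //= eqxx big1 ?addn0 => [|i /negPf-> //].
by rewrite (bigD1 v) //= eqxx big1 ?addn0 => [|i /negPf-> //].
Qed.

Lemma adj_matrix_sym (n : nat) (F : fieldType) (e : rel 'I_n) (k : nat) i j :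
  symmetric e -> adj_matrix F e k i j = adj_matrix F e k j i.
Proof.
move=> e_sym; rewrite !mxE [j == i]eq_sym e_sym /edge_var minC maxC.
by case: eqP => [->|].
Qed.

Lemma adj_matrix_neq0 (n : nat) (F : fieldType) (e : rel 'I_n) (k : nat) i j :
  (adj_matrix F e k i j != 0) = if i == j then (3 * k < lab i)%N else e i j.
Proof.
rewrite mxE; case: ifP => _; case: ifP => _; rewrite ?eqxx ?oner_eq0 //.
by rewrite -msize_poly_eq0 msizeX.
Qed.

Lemma adj_matrixX (n : nat) (F : fieldType) (e : rel 'I_n) (k : nat) i j :
  adj_matrix F e k i j != 0 -> adj_matrix F e k i j = 'X_[edge_mnm i j].
Proof.
rewrite adj_matrix_neq0 mxE /edge_mnm; case: ifP => _ ->; last by [].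
by rewrite mpolyX0.
Qed.

(** * Q' as a sum over directed permutations *)

(** What the deleted entries impose on a permutation with nonzero product: the exit from v_1 is
    prescribed, and no edge at a terminal is traversed back and forth. *)
Definition directed (n k : nat) (s : 'S_n) : bool :=
  [forall i, (lab i == 1%N) ==> (lab (s i) == k + 1)%N] &&
  [forall i in terminals n k, s (s i) != i].

Section Terminals.

Variables (F : fieldType) (n k : nat) (e : rel 'I_n).
Hypothesis k_gt0 : (0 < k)%N.
Hypothesis char2 : 2%N \in [pchar F].
Hypothesis e_sym : symmetric e.
Hypothesis K_nbr : forall v, v \in terminals n k ->
  neighbours e v =
    [set u | (lab u == k + 2 * lab v - 1)%N || (lab u == k + 2 * lab v)%N].

Let adj := adj_matrix F e k.

Lemma pchar2_mpoly : 2%N \in [pchar {mpoly F[n * n]}].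
Proof. exact: (rmorph_pchar (@mpolyC (n * n) F)). Qed.

Lemma edge_terminal u v : u \in terminals n k -> e u v ->
  (lab v == k + 2 * lab u - 1)%N || (lab v == k + 2 * lab u)%N.
Proof.
move=> /K_nbr/setP/(_ v) Nu euv.
by move: Nu; rewrite !inE euv => /esym.
Qed.

Lemma adj_terminal u v : u \in terminals n k -> adj u v != 0 ->
  (lab v == k + 2 * lab u - 1)%N || (lab v == k + 2 * lab u)%N.
Proof.
move=> uK; rewrite adj_matrix_neq0; case: eqP => _; last exact: edge_terminal.
by move: uK; rewrite inE; lia.
Qed.

(** The only choices under which [s] can have a nonzero product: the exit deleted at [i] is the one
    [s] does not take. *)
Definition perm_orientation (s : 'S_n) : {set 'I_n} :=
  [set i in choice_indices n k | (lab (s i) == k + 2 * lab i - 1)%N].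

(** At an index [i] where the two sets differ, the entry [(i, s i)] is deleted or was already
    zero. *)
Lemma prod_orientation_eq0 (s : 'S_n) (o : {set 'I_n}) :
    o \subset choice_indices n k -> o != perm_orientation s ->
  \prod_i orientation F e k o i (s i) = 0.
Proof.
move=> /subsetP oC /eqP o_neq.
have [i iC io] : exists2 i, i \in choice_indices n k &
    (i \in o) != (lab (s i) == k + 2 * lab i - 1)%N.
  apply/exists_inP; apply: contra_notT o_neq; rewrite negb_exists_in.
  move=> /forall_inP H; apply/setP => i; rewrite [RHS]inE.
  case: (boolP (i \in choice_indices n k)) => [/H|iC]; last first.
    by apply: contraNF iC => /oC.
  by rewrite negbK => /eqP.
rewrite (bigD1 i) //= [X in X * _](_ : _ = 0) ?mul0r //.
apply/eqP/contraT; rewrite mxE; case: ifP => [|/negbT]; first by rewrite eqxx.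
rewrite /oriented_away iC negb_or => /andP[_ away].
rewrite mxE; case: ifP => [|_]; first by rewrite eqxx.
move=> /adj_terminal; move: iC io away; rewrite !inE /= => iC.
have -> : (lab i <= k)%N by lia.
by move=> io away /(_ isT); move: io away; case: (i \in o); lia.
Qed.

(** For [i] in [choice_indices], the other deleted entry forbids the return from [s i] to [i]. At
    v_1, the entries cleared in [MG] force the exit to v_{k+1} and forbid the return. *)
Lemma prod_perm_orientation (s : 'S_n) :
  \prod_i orientation F e k (perm_orientation s) i (s i) =
    if directed k s then \prod_i adj i (s i) else 0.
Proof.
have [/existsP[i /eqP si0]|] := boolP [exists i, adj i (s i) == 0].
  rewrite (bigD1 i) //= [X in X * _](_ : _ = 0) ?mul0r //.
    by rewrite (bigD1 i) //= si0 mul0r if_same.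
  by rewrite mxE; case: ifP => // _; rewrite mxE; case: ifP.
rewrite negb_exists => /forallP adj_neq0.
have sK i : i \in terminals n k ->
    (lab (s i) == k + 2 * lab i - 1)%N || (lab (s i) == k + 2 * lab i)%N.
  by move=> iK; apply: adj_terminal (adj_neq0 i).
have [/andP[/forallP s1 /forall_inP sK2]|] := boolP (directed k s).
  apply: eq_bigr => i _; rewrite mxE ifF; last first.
    apply/negbTE; rewrite /oriented_away negb_or; apply/andP; split.
      (* Entering the terminal [s i] by a deleted entry means coming from [s (s i)], so that
         [s (s i) = i]. *)
      apply: contraTN isT => /andP[siC]; have siK : s i \in terminals n k.
        by move: siC; rewrite !inE; lia.
      have := sK _ siK; rewrite inE siC /= => ssi /eqP labi.
      have : s (s i) = i.
        by apply: lab_inj; move: ssi labi; case: eqP => [-> _|_ /= /eqP->] ->.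
      by move=> E; have := sK2 _ siK; rewrite E eqxx.
    rewrite !inE; case: (_ <= lab i <= _)%N => //=.
    by case: ifP => /eqP ?; apply/eqP; lia.
  rewrite mxE ifF //; apply/negbTE; rewrite negb_or; apply/andP; split.
    by have := s1 i; case: eqP => //= _ /eqP; lia.
  apply/negP => /andP[/eqP i1 /eqP si1].
  have := s1 (s i); rewrite si1 /= => /eqP ssi.
  have E : s (s i) = i by apply: lab_inj; rewrite ssi i1.
  have siK : s i \in terminals n k.
    by rewrite inE si1.
  by have := sK2 _ siK; rewrite E eqxx.
(* From here on [s] is not directed; a zero factor is found in the row of v_1 or, if [s (s i) = i],
   in row [s i]. *)
have zero_entry i : orientation F e k (perm_orientation s) i (s i) = 0 ->
    \prod_j orientation F e k (perm_orientation s) j (s j) = 0.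
  by move=> si0; rewrite (bigD1 i) //= si0 mul0r.
have [/forallP s1|] :=
  boolP [forall i, (lab i == 1)%N ==> (lab (s i) == k + 1)%N]; last first.
  rewrite negb_forall => /existsP[i]; rewrite negb_imply => /andP[/eqP i1 si] _.
  apply: (zero_entry i); rewrite mxE; case: ifP => // _; rewrite mxE ifT //.
  have /sK : i \in terminals n k by rewrite inE i1.
  by rewrite i1; lia.
rewrite /directed => /nandP[/forallP //|].
rewrite negb_forall_in => /exists_inP[i iK]; rewrite negbK => /eqP ssi.
apply: (zero_entry (s i)); rewrite ssi mxE; have := sK _ iK.
have [i1 | i_neq1] := eqVneq (lab i) 1%N.
  have := s1 i; rewrite i1 /= => /eqP si _; case: ifP => // _.
  by rewrite mxE ifT // si i1 !eqxx orbT.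
move=> si; rewrite ifT // /oriented_away.
have iC : i \in choice_indices n k.
  by move: iK i_neq1; rewrite !inE /lab; lia.
rewrite iC [i \in perm_orientation s]inE iC /=.
by case: eqP si => [->|_ /= ->]; rewrite ?eqxx.
Qed.

(** Signs vanish in characteristic two, and after exchanging the sums each [s] keeps the single
    orientation [perm_orientation s]. *)
Lemma Qprime_perm :
  Qprime F e k = \sum_(s : 'S_n | directed k s) \prod_i adj i (s i).
Proof.
have sgn1 (s : 'S_n) : (-1) ^+ s = 1 :> {mpoly F[n * n]}.
  by case: (odd_perm s); rewrite ?expr0 // expr1 oppr_pchar2 // pchar2_mpoly.
rewrite /Qprime /determinant exchange_big [RHS]big_mkcond; apply: eq_bigr => s _.
have oC : perm_orientation s \subset choice_indices n k.
  by apply/subsetP => i; rewrite inE => /andP[].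
rewrite (bigD1 (perm_orientation s)) //= sgn1 mul1r prod_perm_orientation.
rewrite [X in _ + X]big1 ?addr0 // => o /andP[oC' o_neq].
by rewrite prod_orientation_eq0 ?mulr0.
Qed.

Lemma directed_flip v (s : 'S_n) : lab v = 1%N ->
  directed k (flip v s) = directed k s.
Proof.
move=> v1; congr (_ && _).
  apply: eq_forallb => i; case: eqP => //= i1.
  have -> : i = v by apply: lab_inj; rewrite i1 v1.
  by rewrite flipE connect0.
by apply: eq_forallb_in => i _; rewrite flip_flip_eq.
Qed.

Lemma prod_adjX (s : 'S_n) :
  \prod_i adj i (s i) != 0 -> \prod_i adj i (s i) = 'X_[perm_mnm s].
Proof.
move=> /prodf_neq0 s_neq0; rewrite -mprodXE.
by apply: eq_bigr => i _; apply: adj_matrixX; apply: s_neq0.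
Qed.

(** * From a nonzero Q' to a K-cycle *)

Lemma cycle_of_Qprime : (k <= n)%N ->
  Qprime F e k != 0 -> has_cycle_through e (terminals n k).
Proof.
move=> k_le_n Q_neq0; have n_gt0 : (0 < n)%N by lia.
pose v : 'I_n := Ordinal n_gt0.
have vK : v \in terminals n k by rewrite inE.
have [s] : exists s : 'S_n, [&& directed k s, \prod_i adj i (s i) != 0 &
    [forall x, ~~ fconnect s v x ==> (s (s x) == x)]].
  apply/existsP; apply: contraNT Q_neq0; rewrite negb_exists => /forallP noC.
  rewrite Qprime_perm (bigID (fun s => flip v s == s)) /=.
  (* A permutation fixed by the flip is its own inverse off the cycle of [v], so its term vanishes
     by [noC]. *)
  rewrite big1 ?add0r => [|s /andP[sd /eqP sE]]; last first.
    apply/eqP; apply: contraNT (noC s) => s_neq0; rewrite sd s_neq0 /=.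
    apply/forallP => x; apply/implyP => vx.
    by rewrite -{2}sE flipE (negPf vx) f_finv //; exact: perm_inj.
  rewrite (sum_fixfree_involution_pchar2 pchar2_mpoly (flipK v)) // => s.
  - by rewrite directed_flip // flipK eq_sym.
  - by move=> _; apply: prod_flip => x y; apply: adj_matrix_sym.
  - by case/andP.
case/and3P => /andP[/forallP s1 /forall_inP sK] /prodf_neq0 s_neq0 /forallP s2.
have s_inj := @perm_inj _ s.
have KO : {subset terminals n k <= orbit s v}.
  move=> x xK; rewrite -fconnect_orbit; apply: contraNT (sK _ xK) => vx.
  exact: implyP (s2 x) vx.
have sv : s v != v.
  by rewrite -(inj_eq (@lab_inj _)); have /eqP-> := implyP (s1 v) isT; rewrite /lab /=; lia.
exists (orbit s v); split => //.
  rewrite /ucycle orbit_uniq andbT.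
  (* A nonzero entry is an edge only off the diagonal; no vertex of the orbit is fixed, since [v] is
     not. *)
  apply: (sub_in_cycle (P := fun x => s x != x)) (cycle_orbit s_inj v).
    move=> x y xP _ /eqP <-; have := s_neq0 x isT.
    by rewrite adj_matrix_neq0 eq_sym (negPf xP).
  apply/allP => x; rewrite -fconnect_orbit => /iter_findex <-.
  by elim: (findex _ _ _) => //= m IH; rewrite (inj_eq s_inj).
rewrite size_orbit ltnNge; apply/negP => o2.
have := iter_order s_inj v; have := order_gt0 s v.
case: (order s v) o2 => [|[|[|]]] //= _ _ => [svE|ssvE].
  by rewrite svE eqxx in sv.
by have := sK _ vK; rewrite ssvE eqxx.
Qed.

(** * From a K-cycle to a nonzero Q' *)

(** Labels from [k + 1] to [3 * k] belong to neighbours of terminals, and a cycle through a terminal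
    uses both its neighbours. Hence vertices off the cycle have diagonal entry 1. *)
Lemma lab_gt_notin_cycle c x : (k <= n)%N -> ucycle e c -> (2 < size c)%N ->
  {subset terminals n k <= c} -> x \notin c -> (3 * k < lab x)%N.
Proof.
move=> k_le_n /andP[cyc Uc] c3 Kc xc; rewrite ltnNge; apply/negP => x3k.
have xK : (k < lab x)%N.
  by rewrite ltnNge; apply: contra xc => xk; apply: Kc; rewrite inE.
(* The terminal adjacent to [x]: its label [i] solves [lab x = k + 2i - 1] or [lab x = k + 2i], and
   its ordinal is [i - 1]. *)
have u_lt_n : ((lab x - k).-1./2 < n)%N by lia.
pose u : 'I_n := Ordinal u_lt_n.
have labu : lab u = (lab x - k).-1./2.+1 by [].
have uK : u \in terminals n k by rewrite inE labu; lia.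
have uc := Kc _ uK.
have nu : next c u \in c by rewrite mem_next.
have pu : prev c u \in c by rewrite mem_prev.
have npu : next c u != prev c u.
  rewrite -(inj_eq (can_inj (prev_next Uc))) next_prev //.
  exact: next_next_neq.
have x_nu : lab x != lab (next c u).
  by rewrite (inj_eq (@lab_inj _)); apply: contraNneq xc => ->.
have x_pu : lab x != lab (prev c u).
  by rewrite (inj_eq (@lab_inj _)); apply: contraNneq xc => ->.
rewrite -(inj_eq (@lab_inj _)) in npu.
have := edge_terminal uK (next_cycle cyc uc).
have := edge_terminal uK (_ : e u (prev c u)).
rewrite e_sym (prev_cycle cyc uc) => /(_ isT).
move: npu x_nu x_pu labu; lia.
Qed.

(** The monomial of the rotation [t] along [c] has coefficient 1: a directed permutation with this
    monomial agrees with [t] at v_1, hence everywhere. *)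
Lemma Qprime_neq0_of_directed_cycle c v : irreflexive e -> (k <= n)%N ->
    ucycle e c -> (2 < size c)%N -> {subset terminals n k <= c} ->
    lab v = 1%N -> lab (next c v) = (k + 1)%N ->
  Qprime F e k != 0.
Proof.
move=> e_irr k_le_n c_cyc c3 Kc v1 nv; have /andP[cyc Uc] := c_cyc.
have vc : v \in c by apply: Kc; rewrite inE v1.
(* [next c] is the identity off [c], so [t] fixes the vertices there. *)
pose t : 'S_n := perm (can_inj (prev_next Uc)).
have tE : t =1 next c by move=> x; rewrite permE.
have vtE x : fconnect t v x = (x \in c).
  apply: fconnect_cycle vc _; rewrite (eq_cycle (e' := frel (next c))).
    exact: cycle_next.
  by move=> y z /=; rewrite tE.
have lab1 i : lab i = 1%N -> i = v by rewrite -v1 => /lab_inj.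
have td : directed k t.
  apply/andP; split.
    by apply/forallP => i; apply/implyP => /eqP/lab1 ->; rewrite tE nv.
  by apply/forall_inP => i /Kc ic; rewrite !tE next_next_neq.
have t_neq0 : \prod_i adj i (t i) != 0.
  apply/prodf_neq0 => i _; rewrite adj_matrix_neq0 tE.
  have [ic|ic] := boolP (i \in c).
    by case: eqP (next_cycle cyc ic) => [<-|//]; rewrite e_irr.
  by rewrite next_nth (negPf ic) eqxx (lab_gt_notin_cycle _ c_cyc).
apply/eqP => /(congr1 (mcoeff (perm_mnm t))); apply/eqP.
rewrite Qprime_perm mcoeff0 raddf_sum (bigD1 t) //= prod_adjX //.
rewrite mcoeffX eqxx big1 ?addr0 ?oner_eq0 // => s /andP[sd s_neq_t].
have [->|s_neq0] := eqVneq (\prod_i adj i (s i)) 0; first by rewrite mcoeff0.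
rewrite prod_adjX // mcoeffX; case: eqP => // st.
case/eqP: s_neq_t; apply: (@perm_eq_undirected _ s t v).
- by move=> x y xy; rewrite -!perm_mnmE // st.
- by move=> x; rewrite vtE !tE; exact: next_next_neq.
- by move=> x; rewrite vtE tE next_nth => /negPf ->.
- apply: lab_inj; rewrite tE nv; apply/eqP.
  by case/andP: sd => /forallP/(_ v); rewrite v1.
Qed.

Lemma Qprime_of_cycle : irreflexive e -> (k <= n)%N ->
  has_cycle_through e (terminals n k) -> Qprime F e k != 0.
Proof.
move=> e_irr k_le_n [c [c_cyc c3 Kc]]; have /andP[cyc Uc] := c_cyc.
have n_gt0 : (0 < n)%N by lia.
pose v : 'I_n := Ordinal n_gt0.
have vK : v \in terminals n k by rewrite inE.
have vc := Kc _ vK.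
have := edge_terminal vK (next_cycle cyc vc).
have := edge_terminal vK (_ : e v (prev c v)).
rewrite e_sym (prev_cycle cyc vc) => /(_ isT) pv nv.
have [nv1|nv1] := eqVneq (lab (next c v)) (k + 1)%N.
  exact: (Qprime_neq0_of_directed_cycle e_irr k_le_n c_cyc c3 Kc _ nv1).
(* If [c] leaves v_1 towards v_{k+2}, the reversed cycle leaves it towards v_{k+1}. *)
have npv : lab (next c v) != lab (prev c v).
  rewrite (inj_eq (@lab_inj _)) -(inj_eq (can_inj (prev_next Uc))).
  by rewrite next_prev // next_next_neq.
apply: (@Qprime_neq0_of_directed_cycle (rev c) v) => //.
- rewrite /ucycle rev_uniq Uc andbT rev_cycle.
  by rewrite (eq_cycle (e' := e)) // => x y; rewrite e_sym.
- by rewrite size_rev.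
- by move=> x /Kc; rewrite mem_rev.
- by rewrite next_rev //; move: pv nv nv1 npv; rewrite /lab /=; lia.
Qed.

End Terminals.

Theorem theorem8 (F : fieldType) (char2 : 2%N \in [pchar F])
    (n k : nat) (k_gt1 : (1 < k)%N) (k_le_n : (k <= n)%N)
    (e : rel 'I_n) (e_sym : symmetric e) (e_irr : irreflexive e)
    (K_indep : independent e (terminals n k))
    (K_deg2 : forall v, v \in terminals n k -> #|neighbours e v| = 2%N)
    (K_nbr : forall v, v \in terminals n k ->
       neighbours e v =
         [set u | (lab u == k + 2 * lab v - 1)%N || (lab u == k + 2 * lab v)%N])
    (K_disj : forall u v, u \in terminals n k -> v \in terminals n k ->
       u != v -> neighbours e u :&: neighbours e v = set0) :
  has_cycle_through e (terminals n k) <-> Qprime F e k <> 0.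
Proof.
have k_gt0 := ltnW k_gt1; split=> [cyc|/eqP].
  by apply/eqP; apply: Qprime_of_cycle.
exact: cycle_of_Qprime.
Qed.
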